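(* Let $M$ be a 4-dimensional connected, orientable smooth manifold, let $a$ be a Lorentzian metric on $M$ of signature $(+,-,-,-)$ and $b$ a 1-form on $M$. Put $A(x,\dot x)=a_{ij}(x)\dot x^i\dot x^j$, $B(x,\dot x)=b_i(x)\dot x^i$, $s=B^2/A$, and let $L:\mathcal{A}\to\mathbb{R}$, $L=A\Psi(s)$, be an $(\alpha,\beta)$-metric function. Then $L$ defines a Finsler spacetime structure if and only if there exists a conic subbundle $\mathcal{T}\subset\mathcal{A}$ with connected fibers $\mathcal{T}_x=\mathcal T\cap T_xM$, $x\in M$, obeying the following conditions for every $x\in M$: (i) $A>0$ and $\Psi>0$ on $\mathcal{T}_x$, and $\lim_{\dot x\to\partial\mathcal{T}_x}(A\Psi)=0$. (ii) For all values $s$ corresponding to vectors $\dot x\in\mathcal{T}_x$: $$\Psi-s\Psi'>0,\qquad \left(s-\langle b,b\rangle\right)\frac{d}{ds}\ln\boldsymbol{\sigma}>-1,\qquad\text{where } \boldsymbol{\sigma}=\frac{(\Psi-s\Psi')^2}{\Psi}.$$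
   Context: $\overset{\circ}{TM}=TM\setminus\{0\}$ is the tangent bundle without its zero section, with projection $\pi$ to $M$; $(x^i,\dot x^i)$ are naturally induced coordinates on $TM$. A conic subbundle of $TM$ is a non-empty open submanifold $\mathcal{Q}\subset\overset{\circ}{TM}$ with $\pi(\mathcal{Q})=M$ and $(x,\dot x)\in\mathcal{Q}\Rightarrow(x,\lambda\dot x)\in\mathcal{Q}$ for all $\lambda>0$. A pseudo-Finsler structure on $M$ is a smooth function $L:\mathcal{A}\to\mathbb{R}$ on a conic subbundle $\mathcal{A}$ such that $L(x,\lambda\dot x)=\lambda^2L(x,\dot x)$ for all $\lambda>0$ and $g_{ij}=\frac12\frac{\partial^2L}{\partial\dot x^i\partial\dot x^j}$ is nondegenerate at every point of $\mathcal{A}$; $\mathcal{A}$ is understood to be the maximal subset of $\overset{\circ}{TM}$ with these properties. An $(\alpha,\beta)$-metric is a pseudo-Finsler structure of the form $L=A\Psi(s)$, $s=B^2/A$, with $\Psi$ smooth on $s(\mathcal{A})$; $\Psi'=d\Psi/ds$. $\langle b,b\rangle=a^{ij}b_ib_j$, a function of $x$; $x$ is kept fixed in $s$-derivatives. $L$ defines a Finsler spacetime structure if there exists a connected conic subbundle $\mathcal{T}\subset\mathcal{A}$ with connected fibers $\mathcal{T}_x=\mathcal{T}\cap T_xM$ such that on each $\mathcal{T}_x$: $L>0$, $g$ has signature $(+,-,-,-)$, and $L$ can be continuously extended as $0$ to the boundary $\partial\mathcal{T}_x$ (in $T_xM$). The $\mathcal{T}_x$ are the future-pointing timelike cones of $L$.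 Standing assumption: at each $x\in M$, $\mathcal{T}_x$ and the future-pointing timelike cone $\mathcal{T}^a_x$ of $a$ (one of the two connected components of $\{\dot x\in T_xM: A>0\}$, according to a time orientation of $a$) have non-empty intersection. ''Finsler spacetime'' is always understood with this assumption. *)

(* Defs.v *)
From HB Require Import structures.
From mathcomp Require Import all_boot all_order all_algebra.
From mathcomp Require Import all_classical all_reals all_analysis.

Set Implicit Arguments.
Unset Strict Implicit.
Unset Printing Implicit Defensive.

Import Order.TTheory GRing.Theory Num.Theory.
Import numFieldNormedType.Exports.

Local Open Scope ring_scope.
Local Open Scope classical_set_scope.

(* C^k regularity; only meant for open U and finite-dimensional V. *)
Fixpoint Ck (R : realType) (V W : normedModType R) (k : nat)
    (U : set V) (f : V -> W) : Prop :=
  match k with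
  | 0%N => {in U, continuous f}
  | k'.+1 => (forall x, U x -> differentiable f x) /\
             (forall v, Ck k' U (fun x => 'D_v f x))
  end.

Definition smooth (R : realType) (V W : normedModType R)
    (U : set V) (f : V -> W) : Prop := forall k, Ck k U f.

(* [phi] and [psi] are total functions; they are only meaningful on [dom] and
   on its image [phi @` dom], where they are inverse homeomorphisms. *)
Record chart (R : realType) (n : nat) (X : topologicalType) := Chart {
  dom : set X;
  phi : X -> 'rV[R]_n;
  psi : 'rV[R]_n -> X;
  dom_open : open dom;
  cod_open : open (phi @` dom);
  phiK : {in dom, cancel phi psi};
  phi_continuous : {in dom, continuous phi};
  psi_continuous : {in phi @` dom, continuous psi} }.

Definition cod (R : realType) (n : nat) (X : topologicalType)
    (c : chart R n X) : set 'rV[R]_n := phi c @` dom c.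

Definition transition (R : realType) (n : nat) (X : topologicalType)
    (c c' : chart R n X) : 'rV[R]_n -> 'rV[R]_n := phi c' \o psi c.

Definition compatible (R : realType) (n : nat) (X : topologicalType)
    (c c' : chart R n X) : Prop :=
  smooth (phi c @` (dom c `&` dom c')) (transition c c') /\
  smooth (phi c' @` (dom c `&` dom c')) (transition c' c).

(* [chart_at] selects a preferred chart around each point; it plays no role
   other than providing a concrete model of the tangent spaces. *)
Record smoothManifold (R : realType) (n : nat) := SmoothManifold {
  carrier :> topologicalType;
  hausdorff_carrier : hausdorff_space carrier;
  second_countable_carrier : @second_countable carrier;
  atlas : set (chart R n carrier);
  chart_at : carrier -> chart R n carrier;
  chart_at_atlas : forall x, atlas (chart_at x);
  chart_at_dom : forall x, dom (chart_at x) x;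
  atlas_compatible : forall c c', atlas c -> atlas c' -> compatible c c';
  atlas_maximal : forall c, (forall c', atlas c' -> compatible c c') -> atlas c }.

Arguments atlas {R n} s.
Arguments chart_at {R n} s x.

Definition orientable (R : realType) (n : nat) (M : smoothManifold R n) : Prop :=
  exists O : set (chart R n M),
    [/\ O `<=` atlas M,
        forall x : M, exists2 c, O c & dom c x &
        forall c c', O c -> O c' -> forall x : M, dom c x -> dom c' x ->
          0 < \det ('J (transition c c') (phi c x))].

(* The tangent vector [Tangent x v] is the vector at x whose components in the
   natural coordinates induced by the preferred chart [chart_at M x] are v; in
   this way T_xM is identified, linearly, with R^n. Components in another chart
   are obtained through the differential of the transition map. *)
Record tangent (R : realType) (n : nat) (M : smoothManifold R n) :=
  Tangent { pt : M; vec : 'rV[R]_n }.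

Arguments Tangent {R n M}.

HB.instance Definition _ (R : realType) (n : nat) (M : smoothManifold R n) :=
  gen_eqMixin (tangent M).
HB.instance Definition _ (R : realType) (n : nat) (M : smoothManifold R n) :=
  gen_choiceMixin (tangent M).

(* The vector with natural coordinates (x^i, \dot x^i) = p in the chart of TM
   induced by c. *)
Definition tparam (R : realType) (n : nat) (M : smoothManifold R n)
    (c : chart R n M) (p : 'rV[R]_n * 'rV[R]_n) : tangent M :=
  let x : M := psi c p.1 in
  Tangent x ('d (transition c (chart_at M x)) (p.1) p.2).

(* The part of Q lying over [dom c], read in natural coordinates. *)
Definition tcoord (R : realType) (n : nat) (M : smoothManifold R n)
    (c : chart R n M) (Q : set (tangent M)) : set ('rV[R]_n * 'rV[R]_n) :=
  [set p | cod c p.1 /\ Q (tparam c p)].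

(* The manifold topology of TM: Q is open iff it is open in all natural
   coordinates. *)
Definition topen (R : realType) (n : nat) (M : smoothManifold R n)
    (Q : set (tangent M)) : Prop :=
  forall c, atlas M c -> open (tcoord c Q).

Lemma topenT (R : realType) (n : nat) (M : smoothManifold R n) :
  topen [set: tangent M].
Proof.
move=> c _; rewrite (_ : tcoord c setT = fst @^-1` cod c).
  by apply: open_comp => [p _|]; [exact: cvg_fst|exact: cod_open].
by apply/seteqP; split => p; [case|].
Qed.

Lemma topenI (R : realType) (n : nat) (M : smoothManifold R n) :
  setI_closed (@topen R n M).
Proof.
move=> P Q oP oQ c ac; rewrite (_ : tcoord c _ = tcoord c P `&` tcoord c Q).
  by apply: openI; [exact: oP|exact: oQ].
by apply/seteqP; split => p; [case=> ? []|case=> -[? ?] []].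
Qed.

Lemma topen_bigcup (R : realType) (n : nat) (M : smoothManifold R n)
    (I : Type) (Q : I -> set (tangent M)) :
  (forall i, topen (Q i)) -> topen (\bigcup_i Q i).
Proof.
move=> oQ c ac; rewrite (_ : tcoord c _ = \bigcup_i tcoord c (Q i)).
  by apply: bigcup_open => i _; exact: oQ.
apply/seteqP; split => p; first by case=> ? [i _ ?]; exists i.
by case=> i _ [? ?]; split => //; exists i.
Qed.

HB.instance Definition _ (R : realType) (n : nat) (M : smoothManifold R n) :=
  isOpenTopological.Build (tangent M)
    (@topenT R n M) (@topenI R n M) (@topen_bigcup R n M).

Definition smooth_on (R : realType) (n : nat) (M : smoothManifold R n)
    (Q : set (tangent M)) (f : tangent M -> R) : Prop :=
  forall c, atlas M c ->
    @smooth R ('rV[R]_n * 'rV[R]_n)%type R (tcoord c Q) (f \o tparam c).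

(* The k-th coordinate vector field of c at the point of coordinates p. *)
Definition frame (R : realType) (n : nat) (M : smoothManifold R n)
    (c : chart R n M) (p : 'rV[R]_n) (k : 'I_n) : 'rV[R]_n :=
  vec (tparam c (p, delta_mx 0 k)).

Definition bilin (R : realType) (n : nat) (S : 'M[R]_n) (u v : 'rV[R]_n) : R :=
  \sum_i \sum_j S i j * u 0 i * v 0 j.

Definition lin (R : realType) (n : nat) (w v : 'rV[R]_n) : R :=
  \sum_i w 0 i * v 0 i.

(* Signature (+,-,...,-). *)
Definition lorentz_signature (R : realType) (n : nat) (S : 'M[R]_n) : Prop :=
  exists2 P : 'M[R]_n, P \in unitmx &
    P *m S *m P^T = diag_mx (\row_(i < n) if i == 0%N :> nat then 1 else -1).

(* [a x] and [b x] are the matrices of components of the tensors at x in the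
   preferred chart at x; smoothness is smoothness of the components in every
   chart. *)
Definition lorentzian_metric (R : realType) (n : nat) (M : smoothManifold R n)
    (a : M -> 'M[R]_n) : Prop :=
  [/\ forall x, (a x)^T = a x,
      forall x, lorentz_signature (a x) &
      forall c, atlas M c -> forall i j,
        @smooth R 'rV[R]_n R (cod c)
          (fun p => bilin (a (psi c p)) (frame c p i) (frame c p j))].

Definition one_form (R : realType) (n : nat) (M : smoothManifold R n)
    (b : M -> 'rV[R]_n) : Prop :=
  forall c, atlas M c -> forall i,
    @smooth R 'rV[R]_n R (cod c) (fun p => lin (b (psi c p)) (frame c p i)).

Definition slit (R : realType) (n : nat) (M : smoothManifold R n) :
  set (tangent M) := [set t | vec t != 0].

Definition scale (R : realType) (n : nat) (M : smoothManifold R n)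
  (l : R) (t : tangent M) : tangent M := Tangent (pt t) (l *: vec t).

Definition fiber (R : realType) (n : nat) (M : smoothManifold R n)
  (Q : set (tangent M)) (x : M) : set 'rV[R]_n := [set v | Q (Tangent x v)].

Definition conic_subbundle (R : realType) (n : nat) (M : smoothManifold R n)
    (Q : set (tangent M)) : Prop :=
  [/\ Q !=set0, open Q, Q `<=` @slit R n M, (@pt R n M) @` Q = setT &
      forall t l, Q t -> 0 < l -> Q (scale l t)].

(* g_ij at t, in the natural coordinates induced by the preferred chart at the
   base point; nondegeneracy and signature do not depend on the chart. *)
Definition fundamental_tensor (R : realType) (n : nat) (M : smoothManifold R n)
    (L : tangent M -> R) (t : tangent M) : 'M[R]_n :=
  \matrix_(i, j) (2^-1 *
    'D_(delta_mx 0 i) (fun v : 'rV[R]_n =>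
      'D_(delta_mx 0 j) (fun w : 'rV[R]_n => L (Tangent (pt t) w)) v)
    (vec t)).

Definition pseudo_finsler_on (R : realType) (n : nat) (M : smoothManifold R n)
    (L : tangent M -> R) (Q : set (tangent M)) : Prop :=
  [/\ conic_subbundle Q, smooth_on Q L,
      forall t l, Q t -> 0 < l -> L (scale l t) = l ^+ 2 * L t &
      forall t, Q t -> fundamental_tensor L t \in unitmx].

(* L is represented by a total function which is only meaningful on D, the set
   where the expression defining it makes sense; the domain Q of the structure
   is maximal among the conic subbundles contained in D. *)
Definition pseudo_finsler (R : realType) (n : nat) (M : smoothManifold R n)
    (D : set (tangent M)) (L : tangent M -> R) (Q : set (tangent M)) : Prop :=
  [/\ Q `<=` D, pseudo_finsler_on L Q &
      forall Q', Q' `<=` D -> pseudo_finsler_on L Q' -> Q `<=` Q' -> Q' = Q].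

Section AlphaBeta.
Context (R : realType) (n : nat) (M : smoothManifold R n).
Implicit Types (a : M -> 'M[R]_n) (b : M -> 'rV[R]_n) (t : tangent M).

Definition A_ a t : R := bilin (a (pt t)) (vec t) (vec t).

Definition B_ b t : R := lin (b (pt t)) (vec t).

Definition s_ a b t : R := B_ b t ^+ 2 / A_ a t.

(* <b, b> = a^{ij} b_i b_j *)
Definition bb a b (x : M) : R := bilin (invmx (a x)) (b x) (b x).

Definition L_ a b (Psi : R -> R) t : R := A_ a t * Psi (s_ a b t).

(* Where the expression A Psi(B^2/A) makes sense; I is the domain of Psi. Since
   division is total, A <> 0 has to be required explicitly. *)
Definition ab_domain a b (I : set R) : set (tangent M) :=
  [set t | A_ a t != 0 /\ I (s_ a b t)].

(* Smoothness of Psi on the possibly non-open set s(Q) is smoothness on an open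
   neighbourhood of it: Psi, a total function, is its own extension. *)
Definition ab_metric a b (I : set R) (Psi : R -> R) (Q : set (tangent M)) :=
  pseudo_finsler (ab_domain a b I) (L_ a b Psi) Q /\
  exists U : set R, [/\ open U, s_ a b @` Q `<=` U &
    forall k s, U s -> derivable (derive1n k Psi) s 1].

Definition sigma (Psi : R -> R) (s : R) : R :=
  (Psi s - s * derive1 Psi s) ^+ 2 / Psi s.

(* C picks one of the two timelike cones of a in each tangent space, in such a
   way that around each point some smooth vector field takes values in C. *)
Definition time_orientation a (C : M -> set 'rV[R]_n) : Prop :=
  (forall x, exists2 v, 0 < A_ a (Tangent x v) &
     C x = connected_component [set w | 0 < A_ a (Tangent x w)] v) /\
  (forall x, exists c : chart R n M, exists U : set M,
     exists X : 'rV[R]_n -> 'rV[R]_n,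
     [/\ atlas M c, open U, U x, U `<=` dom c &
       smooth (phi c @` U) X /\
       forall y, U y -> C y (vec (tparam c (phi c y, X (phi c y))))]).

(* For subsets of T_xM, identified with R^n. *)
Definition frontier (S : set 'rV[R]_n) : set 'rV[R]_n := closure S `\` S°.

Definition finsler_spacetime a (L : tangent M -> R) (Q : set (tangent M)) :=
  exists T : set (tangent M),
    [/\ conic_subbundle T /\ T `<=` Q,
        connected T,
        forall x, connected (fiber T x),
        forall x,
          [/\ forall v, fiber T x v -> 0 < L (Tangent x v),
              forall v, fiber T x v ->
                lorentz_signature (fundamental_tensor L (Tangent x v)) &
              exists Lbar : 'rV[R]_n -> R,
                [/\ {within closure (fiber T x), continuous Lbar},
                    forall v, fiber T x v -> Lbar v = L (Tangent x v) &
                    forall v, frontier (fiber T x) v -> Lbar v = 0]] &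
        exists2 C, time_orientation a C & forall x, fiber T x `&` C x !=set0].

Definition condition_i a b (Psi : R -> R) (T : set (tangent M)) (x : M) :=
  (forall v, fiber T x v ->
     0 < A_ a (Tangent x v) /\ 0 < Psi (s_ a b (Tangent x v))) /\
  (forall v0, frontier (fiber T x) v0 ->
     L_ a b Psi (Tangent x v) @[v --> within (fiber T x) (nbhs v0)] --> (0 : R)).

Definition condition_ii a b (Psi : R -> R) (T : set (tangent M)) (x : M) :=
  forall v, fiber T x v -> let s := s_ a b (Tangent x v) in
    0 < Psi s - s * derive1 Psi s /\
    (s - bb a b x) * derive1 (fun r => ln (sigma Psi r)) s > -1.

End AlphaBeta.

(* Main.v *)
(* At a vector v with A > 0 the fundamental tensor of L = A Psi(s) is
     g = p a + Psi' b b + (2 Psi'' / A) c c,  p = Psi - s Psi',  c = B b - s a(v, .),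
   and g(v, v) = A Psi. A symmetric form with g(v, v) > 0 is Lorentzian iff it
   is negative definite on the g-orthogonal complement of v, i.e. iff its Schur
   complement p a + kappa beta beta on the a-orthogonal complement of v is, where
   beta is the part of b orthogonal to v and kappa = Psi' + 2 s Psi'' - s Psi'^2/Psi.
   As <beta, beta> = <b, b> - s and kappa = - p (ln sigma)', the
   Cauchy-Schwarz inequality on that complement turns (ii) into this. Conversely a vector of the
   complement killed by b gives p > 0, and beta itself the other inequality. That
   A > 0 on a Finsler cone follows from connectedness, A having no zero on it.
   For the converse, T is connected because it is open with connected fibers over
   a connected base, and the components of {A > 0} containing the fibers of T
   form a time orientation, constant local sections being available. *)
Require Import Defs.
From mathcomp Require Import all_boot all_order all_algebra.
From mathcomp Require Import all_classical all_reals all_analysis.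
From mathcomp Require Import ring lra.

Set Implicit Arguments.
Unset Strict Implicit.
Unset Printing Implicit Defensive.

Import Order.TTheory GRing.Theory Num.Theory.
Import numFieldNormedType.Exports.

Local Open Scope ring_scope.
Local Open Scope classical_set_scope.

(** * Algebra of bilinear forms and covectors on row vectors *)

Lemma bilinE (R : realType) n (S : 'M[R]_n) (u v : 'rV[R]_n) :
  bilin S u v = (u *m S *m v^T) 0 0.
Proof.
rewrite /bilin mxE exchange_big; apply: eq_bigr => j _ /=.
rewrite mxE big_distrl /=; apply: eq_bigr => i _.
by rewrite mxE (mulrC (S i j)).
Qed.

Lemma linE (R : realType) n (u v : 'rV[R]_n) : lin u v = (u *m v^T) 0 0.
Proof. by rewrite /lin mxE; apply: eq_bigr => i _; rewrite mxE. Qed.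

Lemma linD (R : realType) n (b u v : 'rV[R]_n) : lin b (u + v) = lin b u + lin b v.
Proof. by rewrite !linE linearD mulmxDr mxE. Qed.

Lemma linZ (R : realType) n (b : 'rV[R]_n) k v : lin b (k *: v) = k * lin b v.
Proof. by rewrite !linE linearZ -scalemxAr mxE. Qed.

Lemma bilinDl (R : realType) n (S : 'M[R]_n) u v w :
  bilin S (u + v) w = bilin S u w + bilin S v w.
Proof. by rewrite !bilinE !mulmxDl mxE. Qed.

Lemma bilinZl (R : realType) n (S : 'M[R]_n) k v w :
  bilin S (k *: v) w = k * bilin S v w.
Proof. by rewrite !bilinE -!scalemxAl mxE. Qed.

Lemma bilinDr (R : realType) n (S : 'M[R]_n) u v w :
  bilin S w (u + v) = bilin S w u + bilin S w v.
Proof. by rewrite !bilinE linearD mulmxDr mxE. Qed.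

Lemma bilinZr (R : realType) n (S : 'M[R]_n) k v w :
  bilin S w (k *: v) = k * bilin S w v.
Proof. by rewrite !bilinE linearZ -scalemxAr mxE. Qed.

Lemma bilinC (R : realType) n (S : 'M[R]_n) u v :
  S^T = S -> bilin S u v = bilin S v u.
Proof.
move=> St; rewrite !bilinE -[in LHS](trmxK (u *m S *m v^T)) mxE.
by rewrite !trmx_mul trmxK St mulmxA.
Qed.

Lemma bilinMl (R : realType) n (S P : 'M[R]_n) u v :
  bilin S (u *m P) (v *m P) = bilin (P *m S *m P^T) u v.
Proof. by rewrite !bilinE trmx_mul !mulmxA. Qed.

Lemma bilin_rank1 (R : realType) n (c u v : 'rV[R]_n) :
  bilin (c^T *m c) u v = lin c u * lin c v.
Proof.
rewrite bilinE !linE !mulmxA -mulmxA mxE big_ord1; congr (_ * _).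
by rewrite -[u *m c^T]trmxK mxE trmx_mul trmxK.
Qed.

Lemma bilinDm (R : realType) n (S S' : 'M[R]_n) u v :
  bilin (S + S') u v = bilin S u v + bilin S' u v.
Proof. by rewrite !bilinE mulmxDr mulmxDl mxE. Qed.

Lemma bilinZm (R : realType) n k (S : 'M[R]_n) u v :
  bilin (k *: S) u v = k * bilin S u v.
Proof. by rewrite !bilinE -scalemxAr -scalemxAl mxE. Qed.

Lemma bilin_delta (R : realType) n (S : 'M[R]_n) i j :
  bilin S (delta_mx 0 i) (delta_mx 0 j) = S i j.
Proof. by rewrite bilinE -rowE trmx_delta -colE !mxE. Qed.

(** * Bases adapted to a vector, and the Lorentzian signature *)

(** A nonzero row has rank 1, so in its rank decomposition it is the first row of [row_ebase u]
    multiplied by the invertible 1 by 1 matrix [col_ebase u]; rescaling that row gives [P]. *)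
Lemma exists_unit_first_row (R : realType) n (u : 'rV[R]_(1 + n)) : u != 0 ->
  exists2 P : 'M[R]_(1 + n), P \in unitmx & usubmx P = u.
Proof.
move=> u0; have ru : \rank u = 1%N by rewrite rank_rV u0.
exists (block_mx (col_ebase u) 0 0 1%:M *m row_ebase u).
  rewrite unitmx_mul row_ebase_unit andbT.
  by rewrite unitmxE det_ublock det1 mulr1 -unitmxE col_ebase_unit.
rewrite -[X in _ *m X](vsubmxK (row_ebase u)) mul_block_col col_mxKu mul0mx addr0.
rewrite -[RHS]mulmx_ebase ru (pid_mx_row R n 1) -mulmxA.
rewrite -[X in _ = _ *m (_ *m X)](vsubmxK (row_ebase u)).
rewrite mul_row_col mul0mx addr0.
by rewrite mul1mx.
Qed.

(** Complete [u] to a basis and subtract from each further basis vector its [S]-projection onto [u].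
    The block [S'] is then the Gram matrix of [S] on the orthogonal complement of [u]. *)
Lemma gram_schmidt_step (R : realType) n (S : 'M[R]_(1 + n)) (u : 'rV[R]_(1 + n)) :
  S^T = S -> bilin S u u != 0 ->
  exists E : 'M[R]_(1 + n), exists S' : 'M[R]_n,
    [/\ E \in unitmx, usubmx E = u, S'^T = S' &
        E *m S *m E^T = block_mx (bilin S u u)%:M 0 0 S'].
Proof.
move=> St Suu; have u0 : u != 0.
  by apply: contraNneq Suu => ->; rewrite bilinE mul0mx mul0mx mxE.
have [P Pu Pr] := exists_unit_first_row u0.
set N := P *m S *m P^T.
have Nt : N^T = N by rewrite /N !trmx_mul trmxK St mulmxA.
set al := bilin S u u in Suu *.
have ul : ulsubmx N = al%:M.
  rewrite /N -mulmxA ulsubmxEsub; apply/matrixP => i j.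
  rewrite !ord1 [RHS]mxE eqxx mulr1n /al bilinE -mulmxA !mxE.
  rewrite -{2}Pr -{1}Pr.
  apply: eq_bigr => k _; congr (_ * _); first by rewrite !mxE.
  by rewrite !mxE; apply: eq_bigr => l _; rewrite !mxE.
set c := ursubmx N.
have dl : dlsubmx N = c^T by rewrite trmx_ursub Nt.
(* The column [- al^-1 *: c^T] holds the projection coefficients: it clears the off-diagonal blocks
   of [N] and leaves the Schur complement of [al]. *)
pose E := block_mx 1%:M 0 (- al^-1 *: c^T) 1%:M *m P.
have Nb : N = block_mx al%:M c c^T (drsubmx N) by rewrite -ul -dl submxK.
exists E, (drsubmx N - al^-1 *: (c^T *m c)); split.
- by rewrite unitmx_mul Pu andbT unitmxE det_lblock !det1 mulr1 unitr1.
- by rewrite /E -{1}(vsubmxK P) mul_block_col col_mxKu mul1mx mul0mx addr0.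
- by rewrite linearB /= linearZ /= trmx_mul trmxK trmx_drsub Nt.
rewrite /E trmx_mul !mulmxA -mulmxA -[_ *m S *m _]mulmxA -!mulmxA.
rewrite (mulmxA P) (mulmxA (P *m S)).
rewrite -/N {1}Nb tr_block_mx !mulmx_block !trmx1 !trmx0 !mul0mx !mul1mx !mulmx1.
rewrite !mulmx0 !addr0 !mul_mx_scalar !mul_scalar_mx.
rewrite linearZ /= trmxK -!scalemxAl scalerA -!scalemxAr.
rewrite scalerA mulrN mulfV // !scaleN1r !addNr mulmx0 scaler0 add0r.
by rewrite scaleNr addrC.
Qed.

Lemma bilin_schur_complement (R : realType) n (S E : 'M[R]_(1 + n)) (S' : 'M[R]_n)
    al w :
  E *m S *m E^T = block_mx al%:M 0 0 S' ->
  bilin S (row_mx 0 w *m E) (row_mx 0 w *m E) = bilin S' w w.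
Proof.
move=> ES; rewrite bilinMl ES !bilinE mul_row_block !mul0mx !mulmx0 !add0r.
by rewrite tr_row_mx mul_row_col mul0mx add0r.
Qed.

Lemma row_mx0_unit_neq0 (R : realType) n (E : 'M[R]_(1 + n)) (w : 'rV[R]_n) :
  E \in unitmx -> w != 0 -> row_mx 0 w *m E != 0.
Proof.
move=> Eu; apply: contraNneq => /(congr1 (mulmx^~ (invmx E))).
by rewrite mulmxK // mul0mx => /(congr1 rsubmx); rewrite row_mxKr linear0 => ->.
Qed.

(** Induction on the dimension: split off the first basis vector, normalise it by the square root of
    minus its square, and diagonalise the form left on its orthogonal complement. *)
Lemma negative_definite_diag (R : realType) n (S : 'M[R]_n) : S^T = S ->
  (forall w, w != 0 -> bilin S w w < 0) ->
  exists2 P : 'M[R]_n, P \in unitmx & P *m S *m P^T = - 1%:M.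
Proof.
elim: n S => [|n IH] S St Sneg.
  by exists 1%:M; [exact: unitmx1|apply/matrixP => -[]].
change ('M[R]_(1 + n)) in (type of S).
have u0 : (delta_mx 0 0 : 'rV[R]_(1 + n)) != 0.
  by apply/eqP => /matrixP/(_ 0 0)/eqP; rewrite !mxE !eqxx oner_eq0.
have su := Sneg _ u0.
have [E [S' [Eu Er S't ES]]] := gram_schmidt_step St (ltr0_neq0 su).
have [w w0|Q Qu QS] := IH S' S't.
  rewrite -(bilin_schur_complement w ES).
  by apply: Sneg; exact: row_mx0_unit_neq0.
set al := bilin S _ _ in su ES.
pose k := (Num.sqrt (- al))^-1.
have k0 : k != 0 by rewrite invr_eq0 sqrtr_eq0 -ltNge oppr_gt0.
pose F : 'M[R]_(1 + n) := block_mx k%:M 0 0 Q.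
have Fu : F \in unitmx.
  by rewrite unitmxE det_ublock det_scalar1 unitrM unitfE k0 -unitmxE.
have FS : F *m (E *m S *m E^T) *m F^T = - 1%:M.
  rewrite ES tr_block_mx !mulmx_block !trmx0 !(mul0mx, mulmx0, addr0, add0r) QS.
  rewrite tr_scalar_mx -!scalar_mxM (@scalar_mx_block _ 1 n) opp_block_mx !oppr0.
  congr block_mx; rewrite -scaleN1r scalemx1; congr (_%:M).
  rewrite mulrAC -invfM -expr2 sqr_sqrtr ?oppr_ge0 ?(ltW su) //.
  by rewrite invrN mulNr mulVf // ltr0_neq0.
exists (F *m E); first by rewrite unitmx_mul Fu.
by rewrite trmx_mul -FS !mulmxA.
Qed.

Lemma bilin_minkowski (R : realType) n (u v : 'rV[R]_n.+1) :
  bilin (diag_mx (\row_(i < n.+1) if i == 0%N :> nat then 1 else -1)) u v =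
  u 0 0 * v 0 0 - \sum_(i < n) u 0 (lift ord0 i) * v 0 (lift ord0 i).
Proof.
rewrite bilinE mul_mx_diag mxE big_ord_recl !mxE /= mulr1; congr (_ + _).
by rewrite -sumrN; apply: eq_bigr => i _; rewrite !mxE /= mulrN1 mulNr.
Qed.

(** Splitting off [u] leaves a negative definite block, which [negative_definite_diag] brings to
    minus the identity; [u] itself is normalised to square 1. *)
Lemma lorentz_signature_perp (R : realType) n (S : 'M[R]_(1 + n)) u :
  S^T = S -> 0 < bilin S u u ->
  (forall w, w != 0 -> bilin S u w = 0 -> bilin S w w < 0) ->
  lorentz_signature S.
Proof.
move=> St Su Sneg.
have [E [S' [Eu Er S't ES]]] := gram_schmidt_step St (lt0r_neq0 Su).
have [w w0|Q Qu QS] := negative_definite_diag S't.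
  rewrite -(bilin_schur_complement w ES).
  apply: Sneg; first exact: row_mx0_unit_neq0.
  have -> : u = row_mx 1%:M 0 *m E.
    by rewrite -(vsubmxK E) mul_row_col mul0mx addr0 mul1mx Er.
  rewrite bilinMl ES bilinE mul_row_block !mul0mx !mulmx0 !addr0.
  by rewrite tr_row_mx mul_row_col trmx0 mulmx0 mul0mx addr0 mxE.
pose k := (Num.sqrt (bilin S u u))^-1.
have k0 : k != 0 by rewrite invr_eq0 sqrtr_eq0 -ltNge.
pose F : 'M[R]_(1 + n) := block_mx k%:M 0 0 Q.
have Fu : F \in unitmx.
  by rewrite unitmxE det_ublock det_scalar1 unitrM unitfE k0 -unitmxE.
exists (F *m E); first by rewrite unitmx_mul Fu.
transitivity (F *m (E *m S *m E^T) *m F^T); first by rewrite trmx_mul !mulmxA.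
rewrite ES tr_block_mx !mulmx_block !trmx0 !(mul0mx, mulmx0, addr0, add0r) QS.
rewrite tr_scalar_mx -!scalar_mxM mulrAC -invfM -expr2 sqr_sqrtr ?(ltW Su) //.
rewrite mulVf ?lt0r_neq0 //; apply/matrixP => i j.
rewrite [RHS]mxE [X in _ = X *+ _]mxE.
case: (split_ordP i) => i' ->; case: (split_ordP j) => j' ->.
- by rewrite block_mxEul mxE ord1 /= !ord1 eqxx.
- by rewrite block_mxEur mxE ord1 eq_shift.
- by rewrite block_mxEdl mxE ord1 eq_shift.
- by rewrite block_mxEdr !mxE eq_shift /= mulNrn.
Qed.

(** This replaces the signature by a test on the complement of one timelike vector. The forward
    direction is the reversed Cauchy-Schwarz inequality, computed in a basis where [S] is the
    Minkowski form. *)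
Lemma lorentz_signatureP (R : realType) n (S : 'M[R]_n.+1) u :
  S^T = S -> 0 < bilin S u u ->
  lorentz_signature S <->
  forall w, w != 0 -> bilin S u w = 0 -> bilin S w w < 0.
Proof.
move=> St Su; split=> [[P Pu PS] w w0|]; last exact: lorentz_signature_perp.
  have inP (v : 'rV[R]_n.+1) : v = v *m invmx P *m P by rewrite mulmxKV.
  have := inP u; have := inP w.
  move: (u *m invmx P) (w *m invmx P) => y x wx uy.
  rewrite wx uy !bilinMl PS in Su *.
  have {w0} x0 : x != 0.
    by apply: contraNneq w0 => x0; rewrite wx x0 mul0mx.
  rewrite !bilin_minkowski in Su *.
  set X := \sum_(i < n) x _ _ * _; set Y := \sum_(i < n) _ in Su.
  set Z := \sum_(i < n) _.
  have X0 : 0 <= X by apply: sumr_ge0 => i _; rewrite -expr2 sqr_ge0.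
  (* The left factor of each product below is a minor of the two vectors, and the squares of these
     minors add up to this expression. Orthogonality means [Z = y 0 0 * x 0 0]; together with
     [Y < y 0 0 ^+ 2] this forces [X > x 0 0 ^+ 2] when [x 0 0 != 0]. *)
  have key : 0 <= y 0 0 ^+ 2 * X - 2 * y 0 0 * x 0 0 * Z + x 0 0 ^+ 2 * Y.
    rewrite /X /Y /Z !mulr_sumr -sumrB -big_split /=.
    apply: sumr_ge0 => i _.
    rewrite [leRHS](_ : _ =
      (y 0 0 * x 0 (lift ord0 i) - x 0 0 * y 0 (lift ord0 i)) ^+ 2) ?sqr_ge0 //.
    by ring.
  move=> /eqP; rewrite subr_eq0 => /eqP yx.
  have [x00|x00] := eqVneq (x 0 0) 0.
    rewrite x00 mul0r sub0r oppr_lt0 lt_neqAle X0 andbT eq_sym.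
    apply: contraNneq x0 => /eqP; rewrite psumr_eq0 => [|i _]; last first.
      by rewrite -expr2 sqr_ge0.
    move=> /allP xi; apply/eqP/rowP => j; rewrite mxE.
    case: (unliftP ord0 j) => [k|] -> //.
    apply/eqP; rewrite -sqrf_eq0 expr2.
    by apply: (implyP (xi k _)) => //; rewrite mem_index_enum.
  have xx : 0 < x 0 0 ^+ 2 by rewrite exprn_even_gt0.
  have yy : 0 < y 0 0 ^+ 2.
    have Y0 : 0 <= Y by apply: sumr_ge0 => i _; rewrite -expr2 sqr_ge0.
    by rewrite expr2; lra.
  rewrite -(pmulr_rlt0 _ yy) -expr2.
  have : 0 < x 0 0 ^+ 2 * (y 0 0 * y 0 0 - Y) by rewrite mulr_gt0.
  have H2 : 2 * y 0 0 * x 0 0 * Z = 2 * y 0 0 ^+ 2 * x 0 0 ^+ 2.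
    by rewrite -yx; ring.
  by move: key; rewrite H2; lra.
Qed.

(** The matrix with columns [b] and [c] has rank at most 2, fewer than its rows. This is where a
    dimension of at least 3 is used. *)
Lemma exists_common_kernel (R : realType) n (b c : 'rV[R]_n.+3) :
  exists2 w : 'rV[R]_n.+3, w != 0 & lin b w = 0 /\ lin c w = 0.
Proof.
pose N : 'M[R]_(n.+3, 1 + 1) := row_mx b^T c^T.
have : kermx N != 0.
  rewrite -mxrank_eq0 mxrank_ker -lt0n subn_gt0.
  by apply: leq_ltn_trans (rank_leq_col N) _.
case/rowV0Pn => w /sub_kermxP; rewrite mul_mx_row => + w0.
rewrite -[0](@row_mx0 _ _ 1 1) => /eq_row_mx[wb wc]; exists w => //.
have linC (d : 'rV[R]_n.+3) : lin d w = (w *m d^T) 0 0.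
  by rewrite linE -[d *m _]trmxK mxE trmx_mul trmxK.
by rewrite !linC wb wc !mxE.
Qed.

Lemma lorentz_signature_unit (R : realType) n (S : 'M[R]_n) :
  lorentz_signature S -> S \in unitmx.
Proof.
case=> P Pu PS; have : P *m S *m P^T \in unitmx.
  rewrite PS unitmxE det_diag unitfE; apply/prodf_neq0 => i _.
  by rewrite mxE; case: ifP; rewrite ?oppr_eq0 oner_eq0.
by rewrite !unitmx_mul => /andP[/andP[]].
Qed.

(** * Signature of the fundamental tensor as linear algebra *)

(** The numbers [psi0], [psi1], [psi2] stand for the values of Psi and its first two derivatives at
    [s], which separates the signature question from calculus. *)
Definition ab_hessian (R : realType) n (S : 'M[R]_n) (b v : 'rV[R]_n)
    (psi0 psi1 psi2 : R) : 'M[R]_n :=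
  let A := bilin S v v in let B := lin b v in let s := B ^+ 2 / A in
  let c := B *: b - s *: (v *m S) in
  (psi0 - s * psi1) *: S + psi1 *: (b^T *m b) + (2 * psi2 / A) *: (c^T *m c).

Lemma lin_mulmx (R : realType) n (S : 'M[R]_n) v w : lin (v *m S) w = bilin S v w.
Proof. by rewrite linE bilinE. Qed.

Lemma linDZl (R : realType) n (b c w : 'rV[R]_n) k l :
  lin (k *: b - l *: c) w = k * lin b w - l * lin c w.
Proof. by rewrite !linE mulmxBl -!scalemxAl !mxE. Qed.

Lemma bilin_ab_hessian (R : realType) n (S : 'M[R]_n) b v psi0 psi1 psi2 u w :
  let A := bilin S v v in let B := lin b v in let s := B ^+ 2 / A in
  bilin (ab_hessian S b v psi0 psi1 psi2) u w =
  (psi0 - s * psi1) * bilin S u w + psi1 * (lin b u * lin b w) +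
  2 * psi2 / A * ((B * lin b u - s * bilin S v u) * (B * lin b w - s * bilin S v w)).
Proof.
by rewrite /ab_hessian /= !bilinDm !bilinZm !bilin_rank1 !linDZl !lin_mulmx.
Qed.

Lemma ab_hessian_sym (R : realType) n (S : 'M[R]_n) b v psi0 psi1 psi2 :
  S^T = S -> (ab_hessian S b v psi0 psi1 psi2)^T = ab_hessian S b v psi0 psi1 psi2.
Proof.
move=> St; rewrite /ab_hessian /=; move: (_ - _ *: (v *m S)) => c.
by rewrite !linearD !linearZ /= !trmx_mul !trmxK St.
Qed.

(** Vectors orthogonal to [v] for the two forms differ by multiples of [v]. After this shift the new
    form is [p * bilin S w w + kappa * lin b w ^+ 2] on the [S]-complement of [v], where [S] is
    negative definite. *)
Lemma lorentz_ab_hessian (R : realType) n (S : 'M[R]_n.+3) (b v : 'rV[R]_n.+3)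
    (psi0 psi1 psi2 : R) :
  let s := lin b v ^+ 2 / bilin S v v in let p := psi0 - s * psi1 in
  let kappa := psi1 + 2 * s * psi2 - s * psi1 ^+ 2 / psi0 in
  S^T = S -> lorentz_signature S -> 0 < bilin S v v -> 0 < psi0 ->
  lorentz_signature (ab_hessian S b v psi0 psi1 psi2) <->
  0 < p /\ 0 < p + kappa * (bilin (invmx S) b b - s).
Proof.
move=> s p kappa St Sl A0 psi0_gt0.
have Su := lorentz_signature_unit Sl.
have Sneg := (lorentz_signatureP St A0).1 Sl.
set A := bilin S v v in s p kappa A0 *; set B := lin b v in s p kappa *.
have AN0 : A != 0 by rewrite lt0r_neq0.
have psi0N0 : psi0 != 0 by rewrite lt0r_neq0.
have sA : s * A = B ^+ 2 by rewrite /s divfK.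
set G := ab_hessian _ _ _ _ _ _.
have GE u w : bilin G u w = p * bilin S u w + psi1 * (lin b u * lin b w) +
  2 * psi2 / A * ((B * lin b u - s * bilin S v u) * (B * lin b w - s * bilin S v w)).
  exact: bilin_ab_hessian.
(* The rank-one term in [c] dies against [v], because [B * B = s * A]. *)
have Gv w : bilin G v w = p * bilin S v w + psi1 * B * lin b w.
  by rewrite GE -/A -/B sA expr2 subrr mul0r mulr0 addr0 mulrA.
have Gvv : bilin G v v = A * psi0.
  by rewrite Gv -/A -/B -mulrA -expr2 -sA /p; ring.
have G0 : 0 < bilin G v v by rewrite Gvv mulr_gt0.
apply: (iff_trans (lorentz_signatureP _ G0)); first exact: ab_hessian_sym.
(* Orthogonality to [v] determines [l]; eliminating it produces [kappa]. *)
have GS l w : bilin S v w = 0 -> bilin G v (l *: v + w) = 0 ->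
    bilin G (l *: v + w) (l *: v + w) = p * bilin S w w + kappa * lin b w ^+ 2.
  rewrite Gv GE !(bilinDr, bilinDl, bilinZl, bilinZr, linD, linZ) => vw.
  rewrite (bilinC w v St) vw -/A -/B !(mulr0, addr0, add0r).
  move=> H.
  have lE : l = - (psi1 * B * lin b w) / (A * psi0).
    have H' : l * (A * psi0) = - (psi1 * B * lin b w).
      have -> : l * (A * psi0) = p * (l * A) + psi1 * l * (s * A).
        by rewrite /p; ring.
      by rewrite sA -[RHS]add0r -H; ring.
    by rewrite -H' mulfK // mulf_neq0.
  rewrite lE /kappa /p /s; field; by rewrite psi0N0 AN0.
(* The [S]-dual vector of [b], projected along [v]: on the complement of [v] it represents [b], and
   its square is [<b,b> - s]. *)
pose beta := b *m invmx S - (B / A) *: v.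
have betaN : beta = (b *m invmx S) + (- (B / A)) *: v by rewrite scaleNr.
have Sb w : bilin S (b *m invmx S) w = lin b w.
  by rewrite bilinE linE mulmxKV.
have bb : lin b (b *m invmx S) = bilin (invmx S) b b.
  by rewrite linE bilinE trmx_mul trmx_inv St mulmxA.
have vbeta : bilin S v beta = 0.
  by rewrite betaN bilinDr bilinZr bilinC // Sb -/A -/B mulNr divfK // subrr.
have bbeta : lin b beta = bilin (invmx S) b b - s.
  by rewrite betaN linD linZ bb -/B /s; ring.
have Sbeta w : bilin S v w = 0 -> bilin S beta w = lin b w.
  by move=> vw; rewrite betaN bilinDl bilinZl Sb vw mulr0 addr0.
rewrite -bbeta; set r := lin b beta.
have Sbb : bilin S beta beta = r by rewrite Sbeta.
clear betaN; clearbody beta.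
split=> [Gneg|[p0 pk] w w0 vw].
- have p0 : 0 < p.
    (* On such a [w] the form [G] is just [p] times [S], and both values are negative. *)
    have [w w0 [bw vw]] := exists_common_kernel b (v *m S).
    rewrite lin_mulmx in vw.
    have Sw := Sneg w w0 vw.
    have := Gneg w w0; rewrite Gv GE bw vw !(mulr0, addr0, mul0r, subr0).
    by move=> /(_ erefl); rewrite nmulr_llt0.
  split=> //.
  have [beta0|betaN0] := eqVneq beta 0.
    by rewrite -Sbb beta0 bilinE mul0mx mul0mx mxE mulr0 addr0.
  have r0 : r < 0 by rewrite -Sbb; exact: Sneg.
  (* The multiple of [v] that makes [beta] orthogonal to [v] for [G]; the value of [G] there is
     [r * (p + kappa * r)] with [r < 0]. *)
  pose l := - (psi1 * B * r) / (A * psi0).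
  have vl : bilin G v (l *: v + beta) = 0.
    rewrite bilinDr bilinZr Gvv [X in _ + X]Gv vbeta -/r mulr0 add0r /l.
    by rewrite divfK ?mulf_neq0 // addNr.
  have lb0 : l *: v + beta != 0.
    apply: contraNneq betaN0 => lb; have : bilin S v (l *: v + beta) = 0.
      by rewrite lb bilinE trmx0 mulmx0 mxE.
    rewrite bilinDr vbeta bilinZr addr0 => /eqP.
    rewrite mulf_eq0 (negPf AN0) orbF => /eqP l0.
    by rewrite -lb l0 scale0r add0r.
  have := Gneg _ lb0 vl; rewrite GS // Sbb -/r.
  have -> : p * r + kappa * r ^+ 2 = r * (p + kappa * r) by ring.
  by rewrite nmulr_rlt0.
pose l := bilin S v w / A; pose w' := w + (- l) *: v.
have wE : w = l *: v + w' by rewrite /w' scaleNr addrCA subrr addr0.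
have vw' : bilin S v w' = 0.
  by rewrite bilinDr bilinZr -/A mulNr divfK // subrr.
clearbody w'.
have w'0 : w' != 0.
  apply: contraNneq w0 => w'0; move: vw; rewrite wE w'0 addr0 bilinZr => /eqP.
  by rewrite mulf_eq0 (gt_eqF G0) orbF => /eqP ->; rewrite scale0r.
have S' := Sneg _ w'0 vw'.
rewrite wE GS //; last by rewrite -wE.
have CS : lin b w' ^+ 2 <= r * bilin S w' w'.
  (* The usual Cauchy-Schwarz combination: [bilin S z z] is [bilin S w' w'] times the difference of
     the two sides, and [bilin S w' w'] is negative. *)
  pose z := bilin S w' w' *: beta + (- lin b w') *: w'.
  have vz : bilin S v z = 0 by rewrite bilinDr !bilinZr vbeta vw' !mulr0 addr0.
  have : bilin S z z <= 0.
    have [->|z0] := eqVneq z 0; first by rewrite bilinE mul0mx mul0mx mxE.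
    by rewrite ltW // Sneg.
  rewrite !(bilinDl, bilinDr, bilinZl, bilinZr) Sbb (bilinC w' beta) //.
  rewrite !Sbeta // -/r => H.
  have : bilin S w' w' * (r * bilin S w' w' - lin b w' ^+ 2) <= 0.
    by move: H; congr (_ <= _); ring.
  by rewrite nmulr_rle0 // subr_ge0.
(* For [kappa <= 0] both terms have the right sign; otherwise [CS] bounds the sum by
   [bilin S w' w' * (p + kappa * r)]. *)
have [k0|k0] := leP kappa 0.
  by rewrite -[ltRHS]addr0 ltr_leD ?pmulr_rlt0 ?mulr_le0_ge0 ?sqr_ge0.
apply: (le_lt_trans (y := bilin S w' w' * (p + kappa * r))).
  by rewrite mulrDr (mulrC p) lerD2l [leRHS]mulrCA (ler_pM2l k0) [leRHS]mulrC.
by rewrite nmulr_rlt0.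
Qed.

(** * Fibre derivatives of A Psi(s) and the derivative of ln sigma *)

Lemma lin_continuous (R : realType) n (b : 'rV[R]_n) : continuous (lin b).
Proof.
apply: (continuous_big (op := +%R)) => [|i _]; first exact: add_continuous.
by move=> v; apply: continuousM; [exact: cst_continuous|exact: coord_continuous].
Qed.

Lemma quadratic_continuous (R : realType) n (S : 'M[R]_n) :
  continuous (fun v => bilin S v v).
Proof.
apply: (continuous_big (op := +%R)) => [|i _]; first exact: add_continuous.
apply: (continuous_big (op := +%R)) => [|j _]; first exact: add_continuous.
move=> v; apply: (@continuousM _ _
  (fun v : 'rV_n => S i j * v 0 i) (fun v => v 0 j));
  last exact: coord_continuous.
by apply: continuousM; [exact: cst_continuous|exact: coord_continuous].
Qed.

(** Both difference quotients are the same function of [h]. Directional derivatives thus reduce to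
    one real variable, where linear and quadratic forms become polynomials in [h]. *)
Lemma is_derive_lineP (R : realType) (V : normedModType R) (f : V -> R) v d df :
  is_derive v d f df <-> is_derive (0 : R) 1 (fun h => f (h *: d + v)) df.
Proof.
have E : 'D_d f v = 'D_1 (fun h : R => f (h *: d + v)) 0.
  rewrite /derive; set g := fun h => h^-1 *: _; set k := fun h => h^-1 *: _.
  suff -> : g = k by []; apply/funext => h; rewrite /g /k /=.
  by rewrite addr0 scale0r add0r [_%:A]mulr1.
split=> -[D <-]; split; rewrite ?E //; first exact/(derivable1P f v d).1.
exact/(derivable1P f v d).2.
Qed.

Lemma is_derive_comp (R : realType) (V : normedModType R) (f : R -> R) (g : V -> R)
    v d a b :
  is_derive (g v) 1 f a -> is_derive v d g b ->
  is_derive v d (fun w => f (g w)) (a * b).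
Proof.
move=> fa /is_derive_lineP gb; apply/is_derive_lineP.
by apply: is_derive1_comp gb; rewrite scale0r add0r.
Qed.

Lemma is_derive_mul (R : realType) (V : normedModType R) (f g : V -> R) v d a b :
  is_derive v d f a -> is_derive v d g b ->
  is_derive v d (fun w => f w * g w) (f v * b + g v * a).
Proof. by move=> fa gb; exact: is_deriveM. Qed.

Lemma is_derive_add (R : realType) (V : normedModType R) (f g : V -> R) v d a b :
  is_derive v d f a -> is_derive v d g b ->
  is_derive v d (fun w => f w + g w) (a + b).
Proof. by move=> fa gb; exact: is_deriveD. Qed.

Lemma is_derive_inv (R : realType) (V : normedModType R) (f : V -> R) v d a :
  f v != 0 -> is_derive v d f a ->
  is_derive v d (fun w => (f w)^-1) (- (f v) ^- 2 * a).
Proof.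
move=> fv fa; have := is_deriveV (f := id) fv (is_derive_id (f v) 1).
by move/is_derive_comp => /(_ _ _ fa); rewrite /GRing.scale /= mulr1.
Qed.

Lemma is_derive_affine (R : realType) (k l : R) :
  is_derive (0 : R) 1 (fun h => h * k + l) k.
Proof.
have := is_derive_add (is_derive_mul (is_derive_id (0 : R) 1)
  (is_derive_cst k (0 : R) 1)) (is_derive_cst l (0 : R) 1).
by move/is_derive_eq; apply; rewrite /= mulr0 add0r addr0 mulr1.
Qed.

Lemma is_derive_lin (R : realType) n (b v d : 'rV[R]_n) :
  is_derive v d (lin b) (lin b d).
Proof.
apply/is_derive_lineP.
rewrite (_ : (fun h => _) = (fun h => h * lin b d + lin b v)).
  exact: is_derive_affine.
by apply/funext => h; rewrite linD linZ.
Qed.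

Lemma is_derive_bilinl (R : realType) n (S : 'M[R]_n) (v d e : 'rV[R]_n) :
  is_derive v d (fun w => bilin S w e) (bilin S d e).
Proof.
apply/is_derive_lineP.
rewrite (_ : (fun h => _) = (fun h => h * bilin S d e + bilin S v e)).
  exact: is_derive_affine.
by apply/funext => h; rewrite bilinDl bilinZl.
Qed.

Lemma is_derive_quadratic (R : realType) n (S : 'M[R]_n) (v d : 'rV[R]_n) :
  S^T = S -> is_derive v d (fun w => bilin S w w) (2 * bilin S v d).
Proof.
move=> St; apply/is_derive_lineP.
rewrite (_ : (fun h => _) =
    (fun h => h * (h * bilin S d d + 2 * bilin S v d) + bilin S v v)).
  have := is_derive_add (is_derive_mul (is_derive_id (0 : R) 1)
    (is_derive_affine (bilin S d d) (2 * bilin S v d)))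
    (is_derive_cst (bilin S v v) (0 : R) 1).
  by move/is_derive_eq; apply; rewrite /= !mul0r !add0r mulr1 addr0.
apply/funext => h; rewrite !(bilinDl, bilinDr, bilinZl, bilinZr) (bilinC d v) //.
ring.
Qed.

(** This is the origin of the covector [c] in [ab_hessian]: it is A/2 times the fibre differential
    of s. *)
Lemma is_derive_ab_s (R : realType) n (S : 'M[R]_n) (b v d : 'rV[R]_n) :
  S^T = S -> bilin S v v != 0 ->
  is_derive v d (fun w => lin b w ^+ 2 / bilin S w w)
    (2 / bilin S v v *
     (lin b v * lin b d - lin b v ^+ 2 / bilin S v v * bilin S v d)).
Proof.
move=> St A0; have dB := is_derive_lin b v d.
have := is_derive_mul (is_derive_mul dB dB)
  (is_derive_inv (f := fun w => bilin S w w) A0 (is_derive_quadratic v d St)).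
by move/is_derive_eq; apply; rewrite /=; field.
Qed.

Lemma is_derive_ab_metric (R : realType) n (S : 'M[R]_n) (b v d : 'rV[R]_n)
    (Psi : R -> R) dPsi :
  S^T = S -> bilin S v v != 0 ->
  is_derive (lin b v ^+ 2 / bilin S v v) 1 Psi dPsi ->
  is_derive v d (fun w => bilin S w w * Psi (lin b w ^+ 2 / bilin S w w))
    (2 * ((Psi (lin b v ^+ 2 / bilin S v v) - lin b v ^+ 2 / bilin S v v * dPsi) *
       bilin S v d + dPsi * (lin b v * lin b d))).
Proof.
move=> St A0 dP.
have := is_derive_mul (is_derive_quadratic v d St)
  (is_derive_comp (g := fun w => lin b w ^+ 2 / bilin S w w) dP
    (is_derive_ab_s b d St A0)).
by move/is_derive_eq; apply; rewrite /=; field.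
Qed.

(** Differentiating the coefficients Psi - s Psi' and Psi' gives -s Psi'' ds and Psi'' ds. Together
    they contribute Psi'' ds(d) c(e), which is the rank-one term since ds = (2/A) c. *)
Lemma is_derive_ab_gradient (R : realType) n (S : 'M[R]_n) (b v d e : 'rV[R]_n)
    (Psi Psi' : R -> R) Psi1 Psi2 :
  let s w := lin b w ^+ 2 / bilin S w w in
  S^T = S -> bilin S v v != 0 ->
  is_derive (s v) 1 Psi Psi1 -> is_derive (s v) 1 Psi' Psi2 -> Psi' (s v) = Psi1 ->
  is_derive v d (fun w => 2 * ((Psi (s w) - s w * Psi' (s w)) * bilin S w e +
      Psi' (s w) * (lin b w * lin b e)))
    (2 * bilin (ab_hessian S b v (Psi (s v)) Psi1 Psi2) d e).
Proof.
move=> s St A0 dP dP' P1.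
have ds : is_derive v d s _ := is_derive_ab_s b d St A0.
have dPs := is_derive_comp (g := s) dP ds.
have dPs' := is_derive_comp (g := s) dP' ds.
have dL := is_derive_add
  (is_derive_mul (is_deriveB dPs (is_derive_mul ds dPs')) (is_derive_bilinl S v d e))
  (is_derive_mul dPs' (is_derive_mul (is_derive_lin b v d)
    (is_derive_cst (lin b e) v d))).
have := is_derive_mul (is_derive_cst (2 : R) v d) dL.
move/is_derive_eq; apply.
by rewrite bilin_ab_hessian /= -/(s v) /cst /= !fctE P1; field.
Qed.

Lemma continuous_ab_s (R : realType) n (S : 'M[R]_n) (b v : 'rV[R]_n) :
  bilin S v v != 0 -> {for v, continuous (fun w => lin b w ^+ 2 / bilin S w w)}.
Proof.
move=> A0; have cB := @lin_continuous _ _ b v.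
have cA := @quadratic_continuous _ _ S v.
have FF : Filter (nbhs v) by exact: nbhs_filter.
have cB2 := cvgM cB cB.
have cV := cvgV (f := fun w => bilin S w w) A0 cA.
exact: (cvgM (cB2 _) (cV _)).
Qed.

Lemma fundamental_tensor_ab (R : realType) n (M : smoothManifold R n)
    (a : M -> 'M[R]_n) (b : M -> 'rV[R]_n) (Psi : R -> R) (U : set R)
    (t : tangent M) :
  (a (pt t))^T = a (pt t) -> A_ a t != 0 -> open U -> U (s_ a b t) ->
  (forall k s, U s -> derivable (derive1n k Psi) s 1) ->
  fundamental_tensor (L_ a b Psi) t =
  ab_hessian (a (pt t)) (b (pt t)) (vec t) (Psi (s_ a b t))
    (derive1 Psi (s_ a b t)) (derive1 (derive1 Psi) (s_ a b t)).
Proof.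
case: t => x v /= St A0 oU Us dPsi.
have dP s : U s -> is_derive s 1 Psi (derive1 Psi s).
  by move=> /(dPsi 0%N)/derivableP; rewrite derive1E.
have dP' s : U s -> is_derive s 1 (derive1 Psi) (derive1 (derive1 Psi) s).
  by move=> /(dPsi 1%N)/derivableP; rewrite derive1E.
apply/matrixP => i j; rewrite mxE /= -[RHS]bilin_delta.
set di := delta_mx 0 i; set dj := delta_mx 0 j.
pose s w := lin (b x) w ^+ 2 / bilin (a x) w w.
(* The gradient formula needs A nonzero and s in [U]; both are open conditions, so it holds near
   [v], which suffices for a second derivative. *)
rewrite (@near_eq_derive _ _ _ _
  (fun w => 2 * ((Psi (s w) - s w * derive1 Psi (s w)) * bilin (a x) w dj +
      derive1 Psi (s w) * (lin (b x) w * lin (b x) dj)))).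
  have /@derive_val -> := @is_derive_ab_gradient _ _ (a x) (b x) v di dj
    Psi (derive1 Psi) _ _ St A0 (dP _ Us) (dP' _ Us) erefl.
  by rewrite mulrA mulVf ?mul1r ?pnatr_eq0.
have cA := @quadratic_continuous _ _ (a x) v.
have cs : s w @[w --> v] --> s v := continuous_ab_s (b := b x) A0.
have nA : \forall w \near v, bilin (a x) w w != 0.
  exact: cvgr_neq0 cA A0.
have nU : \forall w \near v, U (s w).
  by apply: cs; exact: open_nbhs_nbhs.
near=> w.
have Aw : bilin (a x) w w != 0 by near: w.
have Uw : U (s w) by near: w.
exact: (derive_val (is_derive := is_derive_ab_metric (b := b x) dj St Aw (dP _ Uw))).
Unshelve. all: by end_near. Qed.

(** Here ln sigma = 2 ln p - ln Psi with p = Psi - s Psi', and p' = -s Psi''. *)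
Lemma is_derive_ln_sigma (R : realType) (Psi : R -> R) (s Psi2 : R) :
  is_derive s 1 Psi (derive1 Psi s) -> is_derive s 1 (derive1 Psi) Psi2 ->
  0 < Psi s -> 0 < Psi s - s * derive1 Psi s ->
  is_derive s 1 (fun r => ln (sigma Psi r))
    (- (2 * s * Psi2) / (Psi s - s * derive1 Psi s) - derive1 Psi s / Psi s).
Proof.
move=> dP dP' P0 p0.
have dp := is_deriveB dP (is_derive_mul (is_derive_id s 1) dP').
have dsig := is_derive_mul (is_derive_mul dp dp) (is_derive_inv (lt0r_neq0 P0) dP).
have sig0 : 0 < sigma Psi s by rewrite divr_gt0 // exprn_gt0.
have := is_derive_comp (g := sigma Psi) (is_derive1_ln sig0) dsig.
move/is_derive_eq; apply.
rewrite /sigma /= !fctE; field.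
by rewrite !lt0r_neq0.
Qed.

Lemma ln_sigma_condition (R : realType) (Psi : R -> R) (s Psi2 c : R) :
  is_derive s 1 Psi (derive1 Psi s) -> is_derive s 1 (derive1 Psi) Psi2 ->
  0 < Psi s -> 0 < Psi s - s * derive1 Psi s ->
  ((s - c) * derive1 (fun r => ln (sigma Psi r)) s > -1) =
  (0 < Psi s - s * derive1 Psi s +
    (derive1 Psi s + 2 * s * Psi2 - s * derive1 Psi s ^+ 2 / Psi s) * (c - s)).
Proof.
move=> dP dP' P0 p0.
rewrite derive1E (derive_val (is_derive := is_derive_ln_sigma dP dP' P0 p0)).
rewrite -subr_gt0 opprK.
rewrite -[RHS](pmulr_rgt0 _ (x := (Psi s - s * derive1 Psi s)^-1)) ?invr_gt0 //.
congr (0 < _); field.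
by rewrite !lt0r_neq0.
Qed.

(** The pointwise equivalence on which both directions of the theorem rest. *)
Lemma lorentz_fundamental_tensor_ab (R : realType) n (M : smoothManifold R n.+3)
    (a : M -> 'M[R]_n.+3) (b : M -> 'rV[R]_n.+3) (Psi : R -> R) (U : set R)
    (t : tangent M) :
  let s := s_ a b t in
  (a (pt t))^T = a (pt t) -> lorentz_signature (a (pt t)) ->
  0 < A_ a t -> 0 < Psi s -> open U -> U s ->
  (forall k r, U r -> derivable (derive1n k Psi) r 1) ->
  lorentz_signature (fundamental_tensor (L_ a b Psi) t) <->
  0 < Psi s - s * derive1 Psi s /\
  (s - bb a b (pt t)) * derive1 (fun r => ln (sigma Psi r)) s > -1.
Proof.
move=> s St Sl A0 P0 oU Us dPsi.
have dP : is_derive s 1 Psi (derive1 Psi s).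
  by move: (dPsi 0%N s Us) => /derivableP; rewrite derive1E.
have dP' : is_derive s 1 (derive1 Psi) (derive1 (derive1 Psi) s).
  by move: (dPsi 1%N s Us) => /derivableP; rewrite derive1E.
rewrite (fundamental_tensor_ab St _ oU Us dPsi) ?lt0r_neq0 //.
apply: (iff_trans (lorentz_ab_hessian _ _ _ St Sl A0 P0)).
by split=> -[p0 H]; split=> //; move: H; rewrite (ln_sigma_condition _ dP dP').
Qed.

(** * Fibres, local sections and connectedness in the tangent bundle *)

(** The transition from a chart to itself is the identity on the open image of the chart, so its
    differential is the identity. This links the fibres, written with [Tangent], to the topology,
    written in coordinates. *)
Lemma tparam_center (R : realType) n (M : smoothManifold R n) (x : M) (v : 'rV[R]_n) :
  tparam (chart_at M x) (phi (chart_at M x) x, v) = Tangent x v.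
Proof.
set c := chart_at M x.
have cx : dom c x := chart_at_dom x.
have ac : atlas M c := chart_at_atlas x.
have psiK y : dom c y -> psi c (phi c y) = y by move=> cy; rewrite phiK ?inE.
rewrite /tparam /= psiK //; congr Tangent.
have [dfc _] := (atlas_compatible ac ac).1 1%N.
have df : differentiable (transition c c) (phi c x).
  by apply: dfc; exists x.
rewrite -deriveE // (@near_eq_derive _ _ _ _ id) ?derive_id //.
have oc : open (phi c @` dom c) by exact: cod_open.
near=> p.
have [y cy <-] : (phi c @` dom c) p.
  by near: p; apply: open_nbhs_nbhs; split=> //; exists x.
by rewrite /transition /= psiK.
Unshelve. all: by end_near. Qed.

Lemma pair_continuousl (T U : topologicalType) (u : U) :
  continuous (fun t : T => (t, u)).
Proof. by move=> t; apply: cvg_pair; [exact: cvg_id|exact: cvg_cst]. Qed.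

Lemma pair_continuousr (T U : topologicalType) (t : T) :
  continuous (fun u : U => (t, u)).
Proof. by move=> u; apply: cvg_pair; [exact: cvg_cst|exact: cvg_id]. Qed.

Lemma open_fiber (R : realType) n (M : smoothManifold R n) (Q : set (tangent M)) x :
  open Q -> open (fiber Q x).
Proof.
move=> oQ; have := oQ _ (chart_at_atlas x).
set c := chart_at M x => oc.
have -> : fiber Q x = (fun v => (phi c x, v)) @^-1` tcoord c Q.
  apply/seteqP; split => v /=; rewrite /tcoord /fiber /= tparam_center; last by case.
  by split=> //; exists x => //; exact: chart_at_dom.
by apply: open_comp => // v _; exact: pair_continuousr.
Qed.

Lemma continuous_Tangent (R : realType) n (M : smoothManifold R n) (x : M) :
  continuous (Tangent x : 'rV[R]_n -> tangent M).
Proof. by apply/continuousP => Q; exact: open_fiber. Qed.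

(** The section keeps the components [v] constant in the preferred chart at [x]; openness of [Q] in
    natural coordinates keeps it inside [Q] near [x]. *)
Lemma nbhs_local_section (R : realType) n (M : smoothManifold R n)
    (Q : set (tangent M)) (x : M) (v : 'rV[R]_n) : open Q -> Q (Tangent x v) ->
  exists U : set M, [/\ open U, U x, U `<=` dom (chart_at M x) &
    forall y, U y -> Q (tparam (chart_at M x) (phi (chart_at M x) y, v))].
Proof.
set c := chart_at M x => oQ Qv.
have [W oW WE] : exists2 W : set 'rV[R]_n, open W &
    forall p, W p <-> tcoord c Q (p, v).
  exists ((fun p => (p, v)) @^-1` tcoord c Q); last by [].
  apply: open_comp; last exact: oQ _ (chart_at_atlas x).
  by move=> p _; exact: pair_continuousl.
exists (dom c `&` phi c @^-1` W); split.
(* The map [phi c] is continuous only on [dom c], hence the pointwise argument. *)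
- rewrite openE => y [cy Wy]; rewrite /interior.
  have nd : nbhs y (dom c) by apply: open_nbhs_nbhs; split=> //; exact: dom_open.
  have pc : continuous_at y (phi c) by apply: phi_continuous; rewrite inE.
  have nW : nbhs (phi c y) W by apply: open_nbhs_nbhs; split.
  exact: filterI nd (pc W nW).
- split; first exact: chart_at_dom.
  apply/WE; rewrite /tcoord /= tparam_center; split=> //.
  by exists x => //; exact: chart_at_dom.
- by move=> y [].
- by move=> y [_ /WE[]].
Qed.

Lemma pt_tparam (R : realType) n (M : smoothManifold R n) (c : chart R n M) y v :
  dom c y -> pt (tparam c (phi c y, v)) = y.
Proof. by move=> cy; rewrite /= phiK ?inE. Qed.

Lemma open_pt (R : realType) n (M : smoothManifold R n) (Q : set (tangent M)) :
  open Q -> open (@pt R n M @` Q).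
Proof.
move=> oQ; rewrite openE => _ [[x v] Qv <-] /=.
have [U [oU Ux Uc QU]] := nbhs_local_section oQ Qv.
rewrite /interior; apply: (filterS _ (open_nbhs_nbhs (conj oU Ux))) => y Uy.
by eexists; [exact: QU Uy|rewrite pt_tparam //; exact: Uc].
Qed.

(** A relatively clopen [B] contains each fibre of [T] entirely or misses it. The projections of [B]
    and of its complement in [T] are therefore disjoint open sets covering the connected base. *)
Lemma connected_of_fibers (R : realType) n (M : smoothManifold R n)
    (T : set (tangent M)) :
  connected [set: M] -> open T -> @pt R n M @` T = setT ->
  (forall x, connected (fiber T x)) -> connected T.
Proof.
move=> cM oT pT cT B [t0 Bt0] [C oC BC] [D cD BD].
have oB : open B by rewrite BC; exact: openI.
have fB x : fiber B x !=set0 -> fiber B x = fiber T x.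
  move=> B0; apply: cT => //.
    exists (fiber C x); first exact: open_fiber.
    by rewrite BC; apply/seteqP; split.
  exists (fiber D x); last by rewrite BD; apply/seteqP; split.
  exact: (continuous_closedP (Tangent x)).1 (@continuous_Tangent _ _ M x) D cD.
have oTB : open (T `\` B).
  rewrite (_ : T `\` B = T `&` ~` D); first exact: openI oT (closed_openC cD).
  rewrite BD; apply/seteqP; split=> t [Tt nB]; split=> //.
    by move=> Dt; apply: nB.
  by case.
have disj x : (@pt R n M @` B) x -> (@pt R n M @` (T `\` B)) x -> False.
  move=> [[y u] Bu /= <-] [[z w] [Tw nBw] /= zy]; subst z.
  by apply: nBw; change (fiber B y w); rewrite fB //; exists u.
have clopen : (@pt R n M @` B) = ~` (@pt R n M @` (T `\` B)).
  apply/seteqP; split=> x; first by move=> Bx TBx; exact: disj Bx TBx.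
  move=> nx; have : (@pt R n M @` T) x by rewrite pT.
  move=> [t Tt tx]; have [Bt|nBt] := pselect (B t); first by exists t.
  by case: nx; exists t.
have BT : (@pt R n M @` B) = setT.
  apply: cM; first by exists (pt t0); exists t0.
    by exists (@pt R n M @` B); [exact: open_pt|rewrite setTI].
  exists (@pt R n M @` B); last by rewrite setTI.
  by rewrite clopen; exact: open_closedC (open_pt oTB).
apply/seteqP; split=> t; first by rewrite BC => -[].
move=> Tt; apply: contrapT => nBt; apply: (disj (pt t)).
  by rewrite BT.
by exists t.
Qed.

(** * Time orientations, positivity of A and extension by zero *)

Lemma smooth_cst (R : realType) (V W : normedModType R) (U : set V) (w : W) :
  smooth U (fun=> w).
Proof.
move=> k; elim: k w => [|k IH] w /=; first by move=> x _; exact: cst_continuous.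
split=> [x _|v]; first exact: differentiable_cst.
rewrite [X in Ck k U X](_ : _ = fun=> 0); first exact: IH.
by apply/funext => x; exact: derive_cst.
Qed.

(** The choice [X] may be discontinuous: the connected fibre at [y] lies in the component of [X y],
    so any local section of [T], in particular a constant one, takes values in the chosen cones. *)
Lemma time_orientation_of_subbundle (R : realType) n (M : smoothManifold R n)
    (a : M -> 'M[R]_n) (T : set (tangent M)) (X : M -> 'rV[R]_n) :
  open T -> (forall x, connected (fiber T x)) -> (forall t, T t -> 0 < A_ a t) ->
  (forall x, fiber T x (X x)) ->
  time_orientation a
    (fun x => connected_component [set w | 0 < A_ a (Tangent x w)] (X x)).
Proof.
move=> oT cT TA TX; split=> x; first by exists (X x); [exact: TA (TX x)|].
have [U [oU Ux Uc TU]] := nbhs_local_section oT (TX x).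
exists (chart_at M x), U, (fun=> X x); split=> //; first exact: chart_at_atlas.
split=> [|y Uy]; first exact: smooth_cst.
apply: (connected_component_max (TX y) _ (cT y)); first by move=> w /TA.
have : pt (tparam (chart_at M x) (phi (chart_at M x) y, X x)) = y.
  by rewrite pt_tparam //; exact: Uc.
by move: (tparam _ _) (TU y Uy) => [z w] Tw /= <-.
Qed.

Lemma continuous_ab_metric (R : realType) n (S : 'M[R]_n) (b v : 'rV[R]_n)
    (Psi : R -> R) :
  bilin S v v != 0 -> derivable Psi (lin b v ^+ 2 / bilin S v v) 1 ->
  {for v, continuous (fun w => bilin S w w * Psi (lin b w ^+ 2 / bilin S w w))}.
Proof.
move=> A0 /derivable1_diffP/differentiable_continuous cP.
have cA := @quadratic_continuous _ _ S v.
have FF : Filter (nbhs v) by exact: nbhs_filter.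
have cPs := continuous_comp (continuous_ab_s (b := b) A0) cP.
have H := cvgM cA cPs.
exact: H.
Qed.

(** As the form has no zero on [F], its positive part there is cut out both by an open and by a
    closed condition. *)
Lemma connected_quadratic_gt0 (R : realType) n (S : 'M[R]_n) (F : set 'rV[R]_n) :
  connected F -> (forall v, F v -> bilin S v v != 0) ->
  (exists2 v, F v & 0 < bilin S v v) -> forall v, F v -> 0 < bilin S v v.
Proof.
move=> cF F0 [w Fw w0].
suff <- : F `&` [set v | 0 < bilin S v v] = F by move=> v [].
apply: cF; first by exists w.
  exists [set v | 0 < bilin S v v] => //.
  apply: (@open_comp _ _ (fun v => bilin S v v) [set x | 0 < x]); last exact: open_gt.
  by move=> v _; exact: quadratic_continuous.
exists [set v | 0 <= bilin S v v].
  apply: (continuous_closedP (fun v => bilin S v v)).1 [set x | 0 <= x] _;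
    last exact: closed_ge.
  exact: quadratic_continuous.
apply/seteqP; split=> v [Fv v0]; split=> //=; first exact: ltW.
by rewrite lt_neqAle eq_sym F0.
Qed.

(** The limit of [g] along the closure restricts to the smaller set [F], where [g] agrees with
    [f]. *)
Lemma zero_extension_cvg (R : realType) n (F : set 'rV[R]_n) (f g : 'rV[R]_n -> R) :
  {within closure F, continuous g} -> (forall v, F v -> g v = f v) ->
  (forall v, frontier F v -> g v = 0) ->
  forall v0, frontier F v0 -> f v @[v --> within F (nbhs v0)] --> (0 : R).
Proof.
move=> /subspace_continuousP cg gf g0 v0 Fv0 P nP.
have gP : nbhs (g v0) P by rewrite g0.
have ng : nbhs v0 (fun v => closure F v -> P (g v)) := cg v0 (proj1 Fv0) P gP.
change (nbhs v0 (fun v => F v -> P (f v))).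
apply: filterS ng => v Pg Fv; rewrite /= -gf //.
exact: Pg (subset_closure Fv).
Qed.

(** Inside the open set [F] the extension is locally [f]. Near a frontier point, points of [F] are
    controlled by the limit, and all others take the value 0 itself. *)
Lemma zero_extension_continuous (R : realType) n (F : set 'rV[R]_n)
    (f : 'rV[R]_n -> R) :
  open F -> (forall v, F v -> {for v, continuous f}) ->
  (forall v0, frontier F v0 -> f v @[v --> within F (nbhs v0)] --> (0 : R)) ->
  {within closure F, continuous (fun v => if v \in F then f v else 0)}.
Proof.
move=> oF cf f0; apply/subspace_continuousP => v0 clv0 P nP.
change (nbhs (if v0 \in F then f v0 else 0) P) in nP.
change (nbhs v0 (fun v => closure F v -> P (if v \in F then f v else 0))).
have [Fv0|nFv0] := pselect (F v0).
  rewrite mem_set // in nP; have nf : nbhs v0 (f @^-1` P) := cf v0 Fv0 P nP.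
  have nF : nbhs v0 F by apply: open_nbhs_nbhs; split.
  by apply: filterS2 nF nf => v Fv Pv _; rewrite mem_set.
rewrite memNset // in nP.
have Fr : frontier F v0 by split=> //; move/interior_subset.
have nf : nbhs v0 (fun v => F v -> P (f v)) := f0 v0 Fr P nP.
apply: filterS nf => v Pv _.
have [Fv|nFv] := pselect (F v); first by rewrite mem_set //; exact: Pv.
by rewrite memNset //; exact: nbhs_singleton nP.
Qed.

(** * Equivalence of the spacetime structure with the pointwise conditions *)

Theorem theorem6 (R : realType) (M : smoothManifold R 4)
    (a : M -> 'M[R]_4) (b : M -> 'rV[R]_4)
    (I : set R) (Psi : R -> R) (calA : set (tangent M)) :
  connected [set: M] -> orientable M ->
  lorentzian_metric a -> one_form b ->
  ab_metric a b I Psi calA ->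
  finsler_spacetime a (L_ a b Psi) calA <->
  exists T : set (tangent M),
    [/\ conic_subbundle T, T `<=` calA,
        forall x, connected (fiber T x) &
        forall x, condition_i a b Psi T x /\ condition_ii a b Psi T x].
Proof.
move=> cM _ [aT al _] _ [[AD _ _] [U [oU AU dPsi]]].
have AU' t : calA t -> U (s_ a b t) by move=> At; apply: AU; exists t.
split=> [[T [[cT TA] _ cF HT [C [CA _] TC]]]|[T [cT TA cF HT]]]; exists T.
  split=> // x; have [L0 gL [g [cg gL' g0]]] := HT x.
  (* A vanishes nowhere on [calA], and the common vector of the fibre with a timelike cone of [a]
     gives one point where A is positive. *)
  have A0 : forall v, fiber T x v -> 0 < A_ a (Tangent x v).
    apply: (connected_quadratic_gt0 (S := a x) (cF x)) => [v Tv|].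
      by have [] := AD _ (TA _ Tv).
    have [v [Tv Cv]] := TC x; exists v => //.
    by have [w _ CE] := CA x; move: Cv; rewrite CE => /connected_component_sub.
  have P0 v : fiber T x v -> 0 < Psi (s_ a b (Tangent x v)).
    by move=> Tv; have := L0 v Tv; rewrite pmulr_rgt0 ?A0.
  split; first split=> [v Tv|].
  - by split; [exact: A0|exact: P0].
  - exact: zero_extension_cvg cg gL' g0.
  - move=> v Tv; apply/(lorentz_fundamental_tensor_ab (t := Tangent x v)
      (aT x) (al x) (A0 v Tv) (P0 v Tv) oU (AU' _ (TA _ Tv)) dPsi).
    exact: gL.
have [_ oT _ pT _] := cT.
have A0 t : T t -> 0 < A_ a t.
  by case: t => x v; case: (HT x) => -[/(_ v)+ _] _ => /[apply] -[].
have /choice[X TX] : forall x, exists v, fiber T x v.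
  move=> x; have : (@pt R 4 M @` T) x by rewrite pT.
  by move=> [[y v] Tv /= yx]; exists v; rewrite -yx.
split=> //.
- exact: connected_of_fibers.
- move=> x; have [[AP lim] ii] := HT x; split=> [v Tv|v Tv|].
  + by have [Av Pv] := AP v Tv; exact: mulr_gt0.
  + have [Av Pv] := AP v Tv.
    apply/(lorentz_fundamental_tensor_ab (t := Tangent x v)
      (aT x) (al x) Av Pv oU (AU' _ (TA _ Tv)) dPsi).
    exact: ii.
  + exists (fun v => if v \in fiber T x then L_ a b Psi (Tangent x v) else 0); split.
    * apply: zero_extension_continuous lim; first exact: open_fiber.
      move=> v Tv; apply: continuous_ab_metric.
        by apply: lt0r_neq0; exact: A0 _ Tv.
      exact: (dPsi 0%N _ (AU' _ (TA _ Tv))).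
    * by move=> v Tv; rewrite mem_set.
    (* The fibre is open, so none of its points lies on its frontier and the extension is 0
       there. *)
    * move=> v [_ nTv]; rewrite memNset // => Tv; apply: nTv.
      by have := open_fiber (x := x) oT; rewrite openE; apply.
(* The cones are the components through the chosen vectors [X x], which are then common to fibre and
   cone. *)
- eexists; first exact: time_orientation_of_subbundle oT cF A0 TX.
  move=> x; exists (X x); split=> //.
  by apply: connected_component_refl; exact: A0 (TX x).
Qed.
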